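(* Let $d$ and $n$ be positive integers. (i) There is no absolutely maximally entangled (AME) state in $\mathbb{C}^{d}\otimes(\mathbb{C}^{2})^{\otimes 2n}$ when $d\in\{3,4\}$ and $n\ge 4$. (ii) There is no AME state in $\mathbb{C}^{d}\otimes(\mathbb{C}^{3})^{\otimes 2n}$ when either $2\le d\le 8$, $d\ne 3$, $n\ge 6$ and $n\ne 7$; or $d=9$, $n\ge 6$ and $n\notin\{7,9\}$.
   Context: A pure state in a tensor product $\mathbb{C}^{d_1}\otimes\cdots\otimes\mathbb{C}^{d_N}$ is a unit vector $|\psi\rangle$, with density matrix $\rho=|\psi\rangle\langle\psi|$. For $B\subseteq[N]=\{1,\dots,N\}$, the reduced density matrix $\rho_B$ is the partial trace of $\rho$ over the tensor factors indexed by $[N]\setminus B$. The state $|\psi\rangle$ is called an absolutely maximally entangled (AME) state if for every subset $B\subseteq[N]$ with $|B|=\lfloor N/2\rfloor$, $\rho_B=\frac{1}{\prod_{i\in B}d_i}I$ (maximally mixed). Here $N=2n+1$. *)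

(* Defs.v *)
From HB Require Import structures.
From mathcomp Require Import all_boot all_order all_algebra.
From mathcomp Require Import spectral.

Set Implicit Arguments.
Unset Strict Implicit.
Unset Printing Implicit Defensive.

Import Order.TTheory GRing.Theory Num.Theory.
Local Open Scope ring_scope.
Local Open Scope sesquilinear_scope.

(* The tensor product over i : I of the spaces C^(D i) is represented in
   coordinates: its product basis is indexed by the type [config D], and vectors
   and operators are matrices whose indices run through [config D] by way of
   [enum_val] / [enum_rank]. *)
Definition config (I : finType) (D : I -> nat) : finType :=
  {dffun forall i : I, 'I_(D i)}.

Notation "''tvec[' C ]_ D" := 'cV[C]_(#|config D|)
  (at level 8, D at level 2, format "''tvec[' C ]_ D").
Notation "''top[' C ]_ D" := 'M[C]_(#|config D|)
  (at level 8, D at level 2, format "''top[' C ]_ D").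

Definition subdims (I : finType) (D : I -> nat) (B : {set I}) :
    {i : I | i \in B} -> nat :=
  fun i => D (val i).
Arguments subdims {I} D B i.

Definition subconfig (I : finType) (D : I -> nat) (B : {set I}) (x : config D) :
    config (subdims D B) :=
  [ffun i : {i : I | i \in B} => x (val i) : 'I_(subdims D B i)].

(* Partial trace of M over the tensor factors outside B.  On basis operators,
     |x><y|  is sent to  <y_{B^c} | x_{B^c}> |x_B><y_B|,
   so the (a, b) entry is the sum of the entries M_{x,y} over those x, y that
   restrict to a, b on B and agree with each other outside B. *)
Definition ptrace (C : pzRingType) (I : finType) (D : I -> nat) (B : {set I})
    (M : 'top[C]_D) : 'top[C]_(subdims D B) :=
  \matrix_(a, b)
    \sum_(x : config D | subconfig B x == enum_val a)
    \sum_(y : config D | (subconfig B y == enum_val b)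
                      && (subconfig (~: B) y == subconfig (~: B) x))
      M (enum_rank x) (enum_rank y).

Section PureStates.
Variables (C : numClosedFieldType) (I : finType) (D : I -> nat).

Definition pure_state (psi : 'tvec[C]_D) : Prop :=
  (psi ^t* *m psi) 0 0 = 1.

Definition density (psi : 'tvec[C]_D) : 'top[C]_D := psi *m psi ^t*.

Definition AME (psi : 'tvec[C]_D) : Prop :=
  pure_state psi /\
  forall B : {set I}, #|B| = (#|I|./2)%N ->
    ptrace B (density psi) = ((\prod_(i in B) D i)%N%:R^-1)%:M.

End PureStates.

(* Local dimensions of C^d (x) (C^q)^{(x) 2n}, which has 2n+1 tensor factors. *)
Definition dims (d q n : nat) (i : 'I_(n.*2.+1)) : nat :=
  if i == ord0 then d else q.
Arguments dims : clear implicits.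

(* Main.v *)
(* Every reduction of an AME state to at most half of the sites is maximally
   mixed, and complementary reductions of a pure state have equal purity, so the
   purities Tr (rho_T ^ 2) of all reductions are determined by d, q, n.  Two
   families of inequalities then have to hold:
   - the shadow inequalities, sum_T eps_T Tr (rho_T ^ 2) >= 0 for every choice of
     signs, because this sum is <psi psi| prod_i (1 + eps_i SWAP_i) |psi psi>;
   - sum_(T <= A) (-1)^|A \ T| d_T Tr (rho_T ^ 2) >= 0, which is up to scaling the
     squared norm of the part of rho_A that acts nontrivially on every site of A.
   The second family, for A made of the C^d factor and n + 1 other factors, reads
   (n + 1) d <= (d + 1) q ^ 2 and leaves finitely many cases, each of which
   violates a shadow inequality. *)
Require Import Defs.
From mathcomp Require Import all_boot all_order all_algebra.
From mathcomp Require Import reals.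
From mathcomp Require Import complex.
From mathcomp Require Import spectral ring zify ssrZ.

Set Implicit Arguments.
Unset Strict Implicit.
Unset Printing Implicit Defensive.

Import Order.TTheory GRing.Theory Num.Theory.

Local Open Scope ring_scope.

(** * Sums and products over configurations *)

Lemma sum_dffun_prod (S : comPzSemiRingType) (I : finType) (T : I -> finType)
    (h : forall i, T i -> S) :
  \sum_(x : {dffun forall i, T i}) \prod_i h i (x i) =
  \prod_i \sum_(a : T i) h i a.
Proof.
(* In [fprod] form every value carries its index as a tag, so the non-dependent distributivity law
   applies to tagged values. *)
rewrite (reindex (@dffun_of_fprod I T)); last exact/onW_bij/dffun_of_fprod_bij.
under eq_bigr => x _ do under eq_bigr => i _ do rewrite ffunE.
have /= := @big_fprod S 0 1 *%R +%R I T (fun i => [ffun a => h i a]).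
under [LHS]eq_bigr => x _ do under eq_bigr => i _ do rewrite ffunE.
move=> ->.
rewrite -[LHS](@bigA_distr_big_dep _ _ _ _ _ I _ (fun i => [pred a | a \in tagged_with T i])
  (fun i a => untag 0 [ffun a => h i a] a)).
apply: eq_bigr => i _.
have /= <- := @big_tag S 0 +%R I T (fun i => [ffun a => h i a]) i.
by apply: eq_bigr => a _; rewrite ffunE.
Qed.

(** * Gluing two configurations along a set of sites *)

Section Merge.
Variables (I : finType) (D : I -> nat).
Implicit Types (x y z : config D) (S B : {set I}).

Definition merge S x y : config D :=
  [ffun i => (if i \in S then x i else y i) : 'I_(D i)].

Definition agree S x y := [forall i in S, x i == y i].

Lemma mergeE S x y i : merge S x y i = if i \in S then x i else y i.
Proof. by rewrite ffunE. Qed.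

Lemma mergeC S x y : merge (~: S) x y = merge S y x.
Proof. by apply/ffunP => i; rewrite !mergeE inE; case: (i \in S). Qed.

Lemma mergeK S x y : merge S (merge S x y) (merge S y x) = x.
Proof. by apply/ffunP => i; rewrite !mergeE; case: (i \in S). Qed.

Lemma agreeC S x y : agree S x y = agree S y x.
Proof. by apply: eq_forallb => i; rewrite eq_sym. Qed.

(** Exchanging the coordinates of [x] and [y] outside [S] is an involution on pairs, hence a
    reindexing. *)
Lemma sum_merge (V : nmodType) S (F : config D -> config D -> V) :
  \sum_x \sum_y F (merge S x y) (merge S y x) = \sum_x \sum_y F x y.
Proof.
rewrite !pair_bigA /=.
rewrite [RHS](reindex_inj (h := fun u => (merge S u.1 u.2, merge S u.2 u.1))) //.
apply: (can_inj (g := fun u => (merge S u.1 u.2, merge S u.2 u.1))) => -[x y] /=.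
by rewrite !mergeK.
Qed.

Lemma natr_agree (R : comPzSemiRingType) S x y :
  (agree S x y)%:R = \prod_i (if i \in S then (x i == y i)%:R else 1) :> R.
Proof.
case: (boolP (agree S x y)) => [/forall_inP h|].
  by rewrite big1 // => i _; case: ifP => // /h ->.
rewrite negb_forall_in => /exists_inP[i iS ne].
by rewrite (bigD1 i) //= iS (negbTE ne) mul0r.
Qed.

Lemma sum_agree (R : comPzSemiRingType) S x :
  \sum_y (agree S x y)%:R = (\prod_(i in ~: S) D i)%N%:R :> R.
Proof.
under [LHS]eq_bigr do rewrite natr_agree.
rewrite (@sum_dffun_prod R I (fun i => 'I_(D i))
  (fun i a => if i \in S then (x i == a)%:R else 1)).
rewrite natr_prod [RHS]big_mkcond /=; apply: eq_bigr => i _; rewrite inE.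
case: (i \in S) => /=; last by rewrite sumr_const card_ord.
rewrite (bigD1 (x i)) //= eqxx big1 ?addr0 // => a; rewrite eq_sym.
by move/negbTE ->.
Qed.

Lemma card_config : #|config D| = (\prod_i D i)%N.
Proof.
rewrite -(bij_eq_card (dffun_of_fprod_bij (fun i => 'I_(D i)))) card_fprod.
by apply: eq_bigr => i _; rewrite card_ord.
Qed.

End Merge.

(** * Purities and maximally mixed reductions *)

Section Purity.
Variables (C : numClosedFieldType) (I : finType) (D : I -> nat).
Variable p : config D -> C.
Implicit Types (x y z : config D) (S B : {set I}).

(* [z] ranges over configurations of all sites, so this is the (x_S, y_S) entry of
   the reduced density matrix multiplied by the dimension of the sites in S. *)
Definition marginal S x y := \sum_z p (merge S x z) * (p (merge S y z))^*.

(* Tr (rho_S ^ 2) = <psi psi| SWAP_S |psi psi>. *)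
Definition purity S :=
  \sum_x \sum_y p (merge S x y) * p (merge S y x) * (p x)^* * (p y)^*.

(** Merging along the complement yields the same two configurations in the other order, and
    amplitudes commute. *)
Lemma purityC S : purity (~: S) = purity S.
Proof.
by apply: eq_bigr => x _; apply: eq_bigr => y _; rewrite !mergeC [p _ * _]mulrC.
Qed.

Lemma sum_merge_const S (H : config D -> C) :
  \sum_x \sum_y H (merge S x y) = #|config D|%:R * \sum_x H x.
Proof.
rewrite (sum_merge S (fun x _ => H x)) mulr_sumr; apply: eq_bigr => x _.
by rewrite sumr_const mulr_natl.
Qed.

(** Up to scaling, both sides are the squared Hilbert-Schmidt norm of rho_S. The factor counts the
    coordinates that the summand ignores: those of [x] and [y] outside [S], and those of the two
    summation variables inside [S]. *)
Lemma marginal_norm S :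
  \sum_x \sum_y marginal S x y * (marginal S x y)^*
  = #|config D|%:R ^+ 2 * purity S.
Proof.
pose G X Y := p (merge S X Y) * p (merge S Y X) * (p X)^* * (p Y)^*.
transitivity (\sum_x \sum_w \sum_y \sum_z G (merge S x w) (merge S y z)).
  apply: eq_bigr => x _; rewrite exchange_big /=; apply: eq_bigr => y _.
  rewrite /marginal rmorph_sum /= big_distrlr exchange_big /=.
  apply: eq_bigr => w _; apply: eq_bigr => z _; rewrite rmorphM /= conjCK /G.
  have mm u v u' v' : merge S (merge S u v) (merge S u' v') = merge S u v'.
    by apply/ffunP => i; rewrite !mergeE; case: (i \in S).
  by rewrite !mm; ring.
rewrite (sum_merge_const S (fun X => \sum_y \sum_z G X (merge S y z))).
rewrite expr2 -mulrA; congr (_ * _); rewrite mulr_sumr; apply: eq_bigr => X _.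
by rewrite (sum_merge_const S (G X)).
Qed.

(** The equation [marginal B x y = (agree B x y)%:R] expresses that rho_B is maximally mixed;
    tracing out further sites preserves this. *)
Lemma marginal_sub S B : (forall i, 0 < D i)%N -> S \subset B ->
    (forall x y, marginal B x y = (agree B x y)%:R) ->
  forall x y, marginal S x y = (agree S x y)%:R.
Proof.
move=> D_gt0 /subsetP SB mB x y.
(* Average over the values u of the summation variable on B. *)
have N0 : #|config D|%:R != 0 :> C.
  by rewrite pnatr_eq0 -lt0n card_config prodn_gt0.
apply: (mulfI N0).
rewrite -(sum_merge_const B (fun z => p (merge S x z) * (p (merge S y z))^*)).
transitivity (\sum_u marginal B (merge S x u) (merge S y u)).
  apply: eq_bigr => u _; apply: eq_bigr => z _.
  suff E v : merge S v (merge B u z) = merge B (merge S v u) z by rewrite !E.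
  apply/ffunP => i; rewrite !mergeE; case: (boolP (i \in S)) => // /SB ->.
  by [].
rewrite mulr_natl -sumr_const; apply: eq_bigr => u _; rewrite mB; congr (_%:R).
congr nat_of_bool; apply/forall_inP/forall_inP => h i.
  by move=> iS; have := h i (SB i iS); rewrite !mergeE iS.
by rewrite !mergeE; case: ifP => // iS _; apply: h.
Qed.

(** The double sum in [marginal_norm] now counts the pairs agreeing on [S]. With N = [#|config D|]
    there are N d_{S^c} of them, and N = d_S d_{S^c}. *)
Lemma purity_max S : (forall i, 0 < D i)%N ->
    (forall x y, marginal S x y = (agree S x y)%:R) ->
  purity S = ((\prod_(i in S) D i)%N%:R)^-1.
Proof.
move=> D_gt0 mS.
have N0 : #|config D|%:R != 0 :> C.
  by rewrite pnatr_eq0 -lt0n card_config prodn_gt0.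
have dS : (\prod_(i in S) D i)%N%:R != 0 :> C.
  by rewrite pnatr_eq0 -lt0n prodn_gt0.
apply: (mulfI (expf_neq0 2 N0)); rewrite -marginal_norm.
transitivity (\sum_(x : config D) \sum_y (agree S x y)%:R : C).
  apply: eq_bigr => x _; apply: eq_bigr => y _; rewrite mS conjC_nat.
  by case: (agree S x y); rewrite ?mulr1 ?mulr0.
under [LHS]eq_bigr do rewrite sum_agree.
rewrite sumr_const -[LHS]mulr_natl expr2 -mulrA; congr (_ * _).
apply: (mulIf dS); rewrite mulfVK // -natrM mulnC; congr (_%:R).
rewrite card_config [RHS](bigID (mem S)) /=; congr (_ * _)%N.
by apply: eq_bigl => i; rewrite inE.
Qed.

End Purity.

(** * From the partial traces of an AME state to its purities *)

Section AME.
Variables (C : numClosedFieldType) (I : finType) (D : I -> nat).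
Variable psi : 'tvec[C]_D.
Hypothesis D_gt0 : (forall i, 0 < D i)%N.
Implicit Types (x y z : config D) (S B : {set I}).

Definition amplitude x := psi (enum_rank x) 0.

Lemma eq_subconfig B x y : (subconfig B x == subconfig B y) = agree B x y.
Proof.
apply/eqP/forall_inP => [h i iB|h].
  by have /ffunP/(_ (exist _ i iB)) := h; rewrite !ffunE /= => ->.
by apply/ffunP => -[i iB]; rewrite !ffunE; apply/eqP/h.
Qed.

Lemma eq_merge B x z u :
  (merge B x z == u) = agree B x u && agree (~: B) u z.
Proof.
apply/eqP/andP => [<-|[/forall_inP h /forall_inP k]].
  split; apply/forall_inP => i; rewrite mergeE ?inE; first by move=> ->.
  by case: ifP.
apply/ffunP => i; rewrite mergeE; case: ifP => [/h/eqP //|/negbT iB].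
by apply/esym/eqP/k; rewrite inE.
Qed.

Lemma ptrace_density B x y :
  ptrace B (density psi) (enum_rank (subconfig B x)) (enum_rank (subconfig B y))
  = \sum_(u | agree B x u) amplitude u * (amplitude (merge B y u))^*.
Proof.
rewrite mxE !enum_rankK.
apply: eq_big => [u|u _]; first by rewrite eq_subconfig agreeC.
rewrite (big_pred1 (merge B y u)) => [|v]; last first.
  by rewrite /= [v == _]eq_sym eq_merge !eq_subconfig agreeC; congr (_ && _); rewrite agreeC.
by rewrite /density !mxE big_ord1 !mxE.
Qed.

Lemma ptrace_max_marginal B :
    ptrace B (density psi) = ((\prod_(i in B) D i)%N%:R^-1)%:M ->
  forall x y, marginal amplitude B x y = (agree B x y)%:R.
Proof.
move=> ptB x y.
have dB : (\prod_(i in B) D i)%N%:R != 0 :> C.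
  by rewrite pnatr_eq0 -lt0n prodn_gt0.
have := ptrace_density B x y.
rewrite ptB mxE (inj_eq enum_rank_inj) eq_subconfig => /esym E.
apply: (mulfI (invr_neq0 dB)); rewrite mulr_natr -{}E.
pose h u := amplitude u * (amplitude (merge B y u))^*.
(* The sum over [z] is regrouped by [u = merge B x z]: each [u] agreeing with [x] on [B] comes from
   as many [z] as there are configurations on [B], which cancels the inverse dimension. *)
transitivity ((\prod_(i in B) D i)%N%:R^-1 * \sum_z \sum_(u | u == merge B x z) h u).
  congr (_ * _); apply: eq_bigr => z _; rewrite big_pred1_eq /h; congr (_ * _^*).
  by congr amplitude; apply/ffunP => i; rewrite !mergeE; case: ifP.
apply: (canLR (mulKf dB)).
under [LHS]eq_bigr do rewrite big_mkcond /=.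
rewrite exchange_big [X in _ = _ * X]big_mkcond mulr_sumr; apply: eq_bigr => u _ /=.
under [LHS]eq_bigr do rewrite eq_sym eq_merge.
case: (agree B x u) => /=; last by rewrite big1 ?mulr0.
transitivity (\sum_z (agree (~: B) u z)%:R * h u).
  by apply: eq_bigr => z _; case: agree; rewrite ?mul1r ?mul0r.
by rewrite -mulr_suml sum_agree setCK.
Qed.

Lemma AME_purity S : AME psi -> (#|S| <= #|I|./2)%N ->
  purity amplitude S = ((\prod_(i in S) D i)%N%:R)^-1.
Proof.
move=> [_ ptB] leS.
(* [AME] constrains only sets of exactly half size, so [S] is first enlarged to one. *)
have [B SB cB] : exists2 B : {set I}, S \subset B & #|B| = #|I|./2.
  have : (#|I|./2 - #|S| <= #|~: S|)%N.
    by rewrite [#|~: S|]cardsCs setCK; apply: leq_sub2r; lia.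
  case/card_geqP => s [Us ss sS]; exists (S :|: [set x in s]); first exact: subsetUl.
  rewrite cardsU (_ : S :&: _ = set0) ?cards0 ?subn0; last first.
    by apply/setP => i; rewrite !inE; apply/andP => -[iS /sS]; rewrite inE iS.
  by rewrite cardsE (card_uniqP Us) ss subnKC.
by apply: purity_max => //; apply: (marginal_sub D_gt0 SB); apply/ptrace_max_marginal/ptB.
Qed.

End AME.

(** * Positive product kernels on two copies of the system *)

Lemma natr_forall (R : comPzSemiRingType) (I : finType) (b : pred I) :
  \prod_i (b i)%:R = [forall i, b i]%:R :> R.
Proof.
case: (boolP [forall i, b i]) => [/forallP h|].
  by rewrite big1 // => i _; rewrite h.
by rewrite negb_forall => /existsP[i /negbTE bi]; rewrite (bigD1 i) //= bi mul0r.
Qed.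

Lemma sum_delta (R : pzSemiRingType) (T : finType) (t : T) (F : T -> R) :
  \sum_x (x == t)%:R * F x = F t.
Proof.
rewrite (bigD1 t) //= eqxx mul1r big1 ?addr0 // => x /negbTE ->.
by rewrite mul0r.
Qed.

Section ProductKernel.
Variables (C : numClosedFieldType) (I : finType) (D : I -> nat).

Lemma sum_pair_prod (h : forall i, 'I_(D i) * 'I_(D i) -> C) :
  \sum_(u : config D * config D) \prod_i h i (u.1 i, u.2 i)
  = \prod_i \sum_a h i a.
Proof.
rewrite -(pair_bigA _ (fun x y : config D => \prod_i h i (x i, y i))) /=.
transitivity (\sum_(x : config D) \prod_i \sum_b h i (x i, b)).
  apply: eq_bigr => x _.
  exact: (@sum_dffun_prod C I (fun i => 'I_(D i)) (fun i b => h i (x i, b))).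
rewrite (@sum_dffun_prod C I (fun i => 'I_(D i)) (fun i a => \sum_b h i (a, b))).
by apply: eq_bigr => i _; rewrite pair_bigA; apply: eq_bigr => -[].
Qed.

Variables (k : forall i, 'I_(D i) * 'I_(D i) -> 'I_(D i) * 'I_(D i) -> C).
Arguments k : clear implicits.
Variable (c : I -> C).
Hypothesis c_gt0 : forall i, 0 < c i.
Hypothesis k_herm : forall i a b, (k i a b)^* = k i b a.
Hypothesis k_idem : forall i a b, \sum_e k i a e * k i e b = c i * k i a b.

Definition product_kernel (u v : config D * config D) : C :=
  \prod_i k i (u.1 i, u.2 i) (v.1 i, v.2 i).

(** Each [k i] is a Hermitian projection scaled by [c i], so the product of the [c i] times the
    kernel K equals K^* K, and the scaled form is a sum of squared moduli. *)
Lemma product_kernel_psd (f : config D * config D -> C) :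
  0 <= \sum_u \sum_v (f u)^* * product_kernel u v * f v.
Proof.
have c0 : 0 < \prod_i c i by apply: prodr_gt0 => i _.
rewrite -(pmulr_rge0 _ c0).
have KK u v : \sum_w product_kernel u w * product_kernel w v
    = (\prod_i c i) * product_kernel u v.
  rewrite -big_split /=; under [RHS]eq_bigr do rewrite -k_idem.
  rewrite -sum_pair_prod; apply: eq_bigr => w _.
  by rewrite -big_split.
have -> : (\prod_i c i) * (\sum_u \sum_v (f u)^* * product_kernel u v * f v)
    = \sum_w `|\sum_v product_kernel w v * f v| ^+ 2.
  transitivity (\sum_u \sum_v \sum_w (f u)^* *
      (product_kernel u w * product_kernel w v) * f v).
    rewrite mulr_sumr; apply: eq_bigr => u _.
    rewrite mulr_sumr; apply: eq_bigr => v _.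
    by rewrite -mulr_suml -mulr_sumr KK; ring.
  under eq_bigr do rewrite exchange_big /=.
  rewrite exchange_big /=; apply: eq_bigr => w _.
  rewrite normCK rmorph_sum mulrC big_distrlr /=.
  apply: eq_bigr => u _; apply: eq_bigr => v _; rewrite rmorphM rmorph_prod /=.
  rewrite (eq_bigr (fun i => k i (u.1 i, u.2 i) (w.1 i, w.2 i))) => [|i _]; last first.
    exact: k_herm.
  by rewrite /product_kernel; ring.
by apply: sumr_ge0 => w _; rewrite exprn_ge0.
Qed.

End ProductKernel.

(** * The shadow and weight inequalities *)

Section PositivityOfPurities.
Variables (C : numClosedFieldType) (I : finType) (D : I -> nat).
Variable p : config D -> C.

(** Every 1 + (-1)^(s i) SWAP_i is twice a Hermitian projection. Expanding their product, [T]
    collects the sites where the swap is chosen. *)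
Lemma shadow_ge0 (s : I -> bool) :
  0 <= \sum_(T : {set I}) (\prod_(i in T) (-1) ^+ s i) * purity p T.
Proof.
(* k i = (-1)^(s i) SWAP_i + 1 *)
pose k i (a b : 'I_(D i) * 'I_(D i)) : C :=
  (-1) ^+ s i * (b == (a.2, a.1))%:R + (b == a)%:R.
have k_herm i a b : (k i a b)^* = k i b a.
  rewrite /k rmorphD rmorphM /= rmorph_sign !conjC_nat.
  rewrite [b == a]eq_sym; congr (_ * _%:R + _).
  by case: a b => [a1 a2] [b1 b2]; rewrite !xpair_eqE andbC [a1 == _]eq_sym [a2 == _]eq_sym.
have k_idem i a b : \sum_e k i a e * k i e b = 2 * k i a b.
  rewrite /k; under eq_bigr do rewrite mulrDl -mulrA.
  rewrite big_split /= -mulr_sumr !sum_delta /= -surjective_pairing.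
  by rewrite mulrDr mulrA -expr2 sqrr_sign; ring.
have := product_kernel_psd (fun i => ltr0n C 2) k_herm k_idem
  (fun u => p u.1 * p u.2).
rewrite /product_kernel.
under eq_bigr => u _. under eq_bigr => v _.
  rewrite /k bigA_distr mulr_sumr mulr_suml. over.
  rewrite exchange_big /=. over.
rewrite exchange_big /=.
congr (_ <= _); apply: eq_big => [T //|T _]; rewrite /purity.
rewrite [X in _ = _ * X]pair_bigA mulr_sumr; apply: eq_bigr => -[x y] _ /=.
(* [w] is the pair [(x, y)] swapped on [T], the only [v] at which the kernel is nonzero. *)
pose w := (merge T y x, merge T x y).
transitivity (\sum_v (v == w)%:R *
   ((p x * p y)^* * (\prod_(i in T) (-1) ^+ s i) * (p v.1 * p v.2))); last first.
  by rewrite sum_delta /w /= rmorphM; ring.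
apply: eq_bigr => v _.
have -> : (v == w)%:R = \prod_i (if i \in T then ((v.1 i, v.2 i) == (y i, x i))%:R
    else ((v.1 i, v.2 i) == (x i, y i))%:R) :> C.
  transitivity (\prod_i ((v.1 i, v.2 i) == (w.1 i, w.2 i))%:R : C); last first.
    by apply: eq_bigr => i _; rewrite !mergeE; case: ifP.
  rewrite natr_forall; congr (_%:R); congr nat_of_bool.
  apply/eqP/forallP => [-> //|h]; rewrite (surjective_pairing v) (surjective_pairing w).
  by congr (_, _); apply/ffunP => i; have /eqP[] := h i.
rewrite [\prod_(i in T) _]big_mkcond /=.
suff -> : \prod_i (if i \in T then (-1) ^+ s i * ((v.1 i, v.2 i) == (y i, x i))%:R
    else ((v.1 i, v.2 i) == (x i, y i))%:R) =
  (\prod_i (if i \in T then (-1) ^+ s i else 1)) * \prod_i (if i \in T then ((v.1 i, v.2 i) == (y i, x i))%:R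
    else ((v.1 i, v.2 i) == (x i, y i))%:R) :> C by ring.
by rewrite -big_split; apply: eq_bigr => i _ /=; case: ifP => _ //; rewrite mul1r.
Qed.

(** Applying 1 - Q_i at the sites of [A] and Q_i elsewhere to |psi><psi| isolates the part acting
    nontrivially on exactly [A]. The sum is the product of all [D i] times the squared norm of that
    part. *)
Lemma weight_ge0 (A : {set I}) : (forall i, 0 < D i)%N ->
  0 <= \sum_(T : {set I} | T \subset A)
         (-1) ^+ #|A :\: T| * (\prod_(i in T) D i)%N%:R * purity p T.
Proof.
move=> D_gt0.
have Dn0 i : (D i)%:R != 0 :> C by rewrite pnatr_eq0 -lt0n.
(* Q i is the projection onto the maximally entangled vector of two copies of
   site i; acting on |psi><psi|, it replaces site i by the maximally mixed state. *)
pose Q i (a b : 'I_(D i) * 'I_(D i)) : C :=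
  (D i)%:R^-1 * (a.1 == a.2)%:R * (b.1 == b.2)%:R.
(* In the expansion of the product of [F i + G i], [T] is the set of sites where the identity is
   chosen; [F] vanishes outside [A], so only subsets of [A] survive. *)
pose F i (a b : 'I_(D i) * 'I_(D i)) : C := if i \in A then (b == a)%:R else 0.
pose G i (a b : 'I_(D i) * 'I_(D i)) : C := if i \in A then - Q i a b else Q i a b.
pose k i a b := F i a b + G i a b.
have Q_herm i a b : (Q i a b)^* = Q i b a.
  by rewrite /Q !rmorphM /= !conjC_nat fmorphV /= conjC_nat; ring.
have k_herm i a b : (k i a b)^* = k i b a.
  rewrite /k /F /G rmorphD /=; case: (i \in A); rewrite ?rmorphN /= Q_herm.
    by rewrite conjC_nat eq_sym.
  by rewrite rmorph0.
have Q_idem i a b : \sum_e Q i a e * Q i e b = Q i a b.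
  transitivity (\sum_(x < D i) \sum_y (y == x)%:R * ((D i)%:R^-1 * Q i a b)).
    rewrite pair_bigA; apply: eq_bigr => -[x y] _ /=; rewrite /Q /= [y == x]eq_sym.
    by case: (x == y) => /=; ring.
  under eq_bigr do rewrite sum_delta.
  by rewrite sumr_const card_ord -[LHS]mulr_natl mulVKf.
have k_idem i a b : \sum_e k i a e * k i e b = 1 * k i a b.
  rewrite mul1r /k /F /G; case: (i \in A); last first.
    by under eq_bigr do rewrite !add0r; rewrite Q_idem add0r.
  under eq_bigr do rewrite mulrDl !mulrDr !mulNr !mulrN opprK.
  rewrite !big_split /= !sumrN Q_idem !sum_delta.
  have -> : \sum_e Q i a e * (b == e)%:R = Q i a b; last by ring.
  under eq_bigr do rewrite mulrC eq_sym.
  by rewrite sum_delta.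
have := product_kernel_psd (fun i => @ltr01 C) k_herm k_idem
  (fun u => p u.1 * (p u.2)^*).
rewrite /product_kernel.
under eq_bigr => u _. under eq_bigr => v _.
  rewrite /k bigA_distr mulr_sumr mulr_suml. over.
  rewrite exchange_big /=. over.
rewrite exchange_big /=.
have D0 : 0 < \prod_i (D i)%:R :> C by apply: prodr_gt0 => i _; rewrite ltr0n.
rewrite -(pmulr_rge0 _ D0) mulr_sumr.
congr (_ <= _); rewrite [RHS]big_mkcond; apply: eq_big => [T //|T _].
case: ifPn => [/subsetP TA|/subsetPn[i iT iA]]; last first.
  rewrite [X in _ * X]big1 ?mulr0 // => u _; rewrite big1 // => v _.
  by rewrite (bigD1 i) //= iT /F (negbTE iA) mul0r mulr0 mul0r.
(* [e i] is the scalar contributed by site [i]. [b] records the forced coincidences: x' = x and y' =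
   y on [T], x = y and x' = y' off [T]. *)
pose e i : C := if i \in T then 1 else (if i \in A then -1 else 1) / (D i)%:R.
pose b (x y x' y' : config D) := (y == merge T y' x) && (x' == merge T x y').
have kE (x y x' y' : config D) : \prod_i (if i \in T then F i (x i, y i) (x' i, y' i)
    else G i (x i, y i) (x' i, y' i)) = \prod_i e i * (b x y x' y')%:R.
  transitivity (\prod_i (e i * (if i \in T then (x' i == x i) && (y' i == y i)
                               else (x i == y i) && (x' i == y' i))%:R)).
    apply: eq_bigr => i _; rewrite /e /F /G /Q /=.
    case: (boolP (i \in T)) => [/TA ->|_]; first by rewrite mul1r xpair_eqE.
    by case: (i \in A) => /=; case: (x i == y i) => /=; case: (x' i == y' i) => /=; ring.
  rewrite big_split /= natr_forall; congr (_ * _%:R); congr nat_of_bool.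
  apply/forallP/andP => [h|[/eqP -> /eqP ->] i]; last first.
    by rewrite !mergeE; case: (i \in T); rewrite !eqxx.
  split; apply/eqP/ffunP => i; rewrite mergeE; have := h i; case: (i \in T) => /andP[] /eqP ? /eqP ? //.
have sum_pair (V : config D * config D -> C) : \sum_u V u = \sum_x \sum_y V (x, y).
  by rewrite pair_bigA; apply: eq_bigr => -[].
have cE : \prod_i (D i)%:R * \prod_i e i = (-1) ^+ #|A :\: T| * (\prod_(i in T) D i)%N%:R :> C.
  rewrite -prodr_const natr_prod [X in _ = X * _]big_mkcond [X in _ = _ * X]big_mkcond.
  rewrite -!big_split /=; apply: eq_bigr => i _.
  rewrite /e inE; case: (boolP (i \in T)) => [_|_] /=; first by rewrite mul1r mulr1.
  by rewrite mulr1 mulrCA divff // mulr1.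
rewrite -cE -mulrA; congr (_ * _).
rewrite sum_pair mulr_sumr; apply: eq_bigr => x _.
transitivity (\sum_y \sum_y' \sum_x' (y == merge T y' x)%:R * ((x' == merge T x y')%:R *
   (\prod_i e i * ((p x * (p y)^*)^* * (p x' * (p y')^*))))).
  apply: eq_bigr => y _; rewrite sum_pair exchange_big /=.
  apply: eq_bigr => y' _; apply: eq_bigr => x' _; rewrite kE /b -mulnb natrM.
  by ring.
rewrite exchange_big mulr_sumr; apply: eq_bigr => Y _ /=.
under eq_bigr do rewrite -mulr_sumr sum_delta.
by rewrite sum_delta rmorphM /= conjCK; ring.
Qed.

End PositivityOfPurities.

(** * Signed subset sums as polynomial coefficients *)

Section SignedSubsetSum.
Variable R : comNzRingType.

(* Coefficients of (1 + c X) l + c a, with a the coefficient carried from below. *)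
Definition mul1cX (c a : R) (l : seq R) : seq R :=
  (fix loop a l := if l is b :: l' then (b + c * a) :: loop b l' else [:: c * a]) a l.

Lemma nth_mul1cX c a l k : (mul1cX c a l)`_k = l`_k + c * (a :: l)`_k.
Proof.
elim: l a k => [|b l IH] a [|k] //=; rewrite ?nth_nil ?mulr0 ?add0r ?addr0 //.
Qed.

Lemma size_mul1cX c a l : size (mul1cX c a l) = (size l).+1.
Proof. by elim: l a => //= b l IH a; rewrite IH. Qed.

Lemma Poly_mul1cX c l : Poly (mul1cX c 0 l) = (1 + c *: 'X) * Poly l.
Proof.
apply/polyP => k; rewrite coef_Poly nth_mul1cX mulrDl mul1r -scalerAl.
by rewrite coefD coefZ coefXM !coef_Poly; case: k.
Qed.

Definition prod1cX (c : nat -> R) m : seq R :=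
  iteri m (fun i l => mul1cX (c i) 0 l) [:: 1].

Lemma size_prod1cX c m : size (prod1cX c m) = m.+1.
Proof. by elim: m => //= m IH; rewrite size_mul1cX IH. Qed.

Lemma Poly_prod1cX c m :
  Poly (prod1cX c m) = \prod_(i < m) (1 + c i *: 'X).
Proof.
elim: m => [|m IH]; last by rewrite /= Poly_mul1cX -/(prod1cX c m) IH big_ord_recr mulrC.
by rewrite big_ord0 /= cons_poly_def mul0r add0r.
Qed.

Fixpoint dotprod (l : seq R) (g : nat -> R) k : R :=
  if l is a :: l' then a * g k + dotprod l' g k.+1 else 0.

Lemma dotprodE l g k : dotprod l g k = \sum_(i < size l) l`_i * g (k + i)%N.
Proof.
elim: l k => [|a l IH] k /=; first by rewrite big_ord0.
rewrite big_ord_recl addn0 IH; congr (_ + _); apply: eq_bigr => i _.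
by rewrite addSnnS.
Qed.

(** The coefficient of X^k in the product of the 1 + c_i X is the weighted count of the k-element
    sets avoiding [ord0]. This reduces 2^(m+1) subsets to m + 1 terms, few enough to evaluate. *)
Lemma sum_set_dotprod m (e0 : R) (c : nat -> R) (f : bool -> nat -> R) :
  \sum_(T : {set 'I_m.+1}) (\prod_(i in T) (if unlift ord0 i is Some j then c j else e0))
     * f (ord0 \in T) #|T :\ ord0|
  = dotprod (prod1cX c m) (fun k => f false k + e0 * f true k) 0.
Proof.
pose e i := if unlift ord0 i is Some j then c (j : 'I_m) else e0.
rewrite dotprodE size_prod1cX.
pose Q : {poly R} := \prod_(i < m) (1 + c i *: 'X).
have PQ (c0 c1 : R) : (c0 + c1) *: Q = \sum_(T : {set 'I_m.+1})
    ((if ord0 \in T then c1 else c0) * \prod_(i in T :\ ord0) e i) *: 'X^#|T :\ ord0|.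
  (* X marks membership of the sites other than ord0, whose factor is constant. *)
  pose F (i : 'I_m.+1) : {poly R} := if i == ord0 then c1%:P else e i *: 'X.
  pose G (i : 'I_m.+1) : {poly R} := if i == ord0 then c0%:P else 1.
  transitivity (\prod_i (F i + G i)).
    rewrite big_ord_recl /F /G /= -polyCD addrC mul_polyC; congr (_ *: _).
    by apply: eq_bigr => i _; rewrite /e liftK addrC.
  rewrite bigA_distr; apply: eq_big => [T //|T _].
  rewrite (bigD1 ord0) //= /F /G eqxx -if_arg -scalerA -mul_polyC.
  congr (_ * _); first by case: ifP.
  rewrite -prodr_const -mul_polyC rmorph_prod /= -big_split /=.
  rewrite [LHS]big_mkcond [RHS]big_mkcond /=; apply: eq_bigr => i _.
  rewrite !inE; case: eqP => //= _; case: (i \in T) => //.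
  by rewrite mul_polyC.
have coefP (T : {set 'I_m.+1}) (a : R) (g : nat -> R) :
   \sum_(k < m.+1) (a *: 'X^#|T :\ ord0|)`_k * g k = a * g #|T :\ ord0|.
  have lt : (#|T :\ ord0| < m.+1)%N.
    rewrite -[X in (_ < X)%N](card_ord m.+1); apply: proper_card.
    by apply/properP; split; [exact: subset_predT | exists ord0; rewrite ?inE ?eqxx].
  rewrite (bigD1 (Ordinal lt)) //= coefZ coefXn eqxx mulr1 big1 ?addr0 // => k ne.
  by rewrite coefZ coefXn (_ : _ == _ = false) ?mulr0 ?mul0r //; apply: contraNF ne.
have lin (c0 c1 : R) (g : nat -> R) : \sum_(k < m.+1) (c0 + c1) * Q`_k * g k =
   \sum_(T : {set 'I_m.+1}) ((if ord0 \in T then c1 else c0) * \prod_(i in T :\ ord0) e i) * g #|T :\ ord0|.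
  under [RHS]eq_bigr do rewrite -coefP.
  rewrite exchange_big; apply: eq_bigr => k _ /=.
  by rewrite -mulr_suml -coefZ PQ coef_sum.
(* Taking [(c0, c1)] as [(1, 0)] and [(0, e0)] separates the sets without [ord0] from those
   containing it. *)
transitivity (\sum_(k < m.+1) (1 + 0) * Q`_k * f false k + \sum_(k < m.+1) (0 + e0) * Q`_k * f true k).
  rewrite !lin -big_split; apply: eq_bigr => T _ /=.
  case: (boolP (ord0 \in T)) => T0; last first.
    have -> : T :\ ord0 = T.
      by apply/setP => i; rewrite !inE; case: eqP => // ->; rewrite (negbTE T0).
    by rewrite !mul0r addr0 mul1r.
  by rewrite (big_setD1 ord0) //= unlift_none !mul0r add0r.
rewrite -big_split; apply: eq_bigr => k _ /=.
by rewrite /Q -Poly_prod1cX coef_Poly; ring.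
Qed.

End SignedSubsetSum.

(** * Alternating sums over the subsets of a set *)

Section SubsetSums.
Variable I : finType.
Implicit Types A T : {set I}.

(** The sum expands a product over sites whose factor at any site of [A] is 1 - 1. *)
Lemma sum_sign_subset (R : comPzRingType) A : A != set0 ->
  \sum_(T : {set I} | T \subset A) (-1) ^+ #|A :\: T| = 0 :> R.
Proof.
case/set0Pn => a aA.
transitivity (\prod_i ((i \in A)%:R + (if i \in A then -1 else 1) : R)); last first.
  by rewrite (bigD1 a) //= aA subrr mul0r.
rewrite bigA_distr [LHS]big_mkcond; apply: eq_big => [T //|T _].
case: ifPn => [/subsetP TA|/subsetPn[i iT iA]]; last first.
  by rewrite (bigD1 i) //= iT (negbTE iA) mul0r.
rewrite -prodr_const big_mkcond /=; apply: eq_bigr => i _; rewrite inE.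
by case: (boolP (i \in T)) => //= /TA ->.
Qed.

Lemma sum_corank_le1 (V : nmodType) A (h : {set I} -> V) :
    (forall T, T \subset A -> (1 < #|A :\: T|)%N -> h T = 0) ->
  \sum_(T : {set I} | T \subset A) h T = h A + \sum_(i in A) h (A :\ i).
Proof.
move=> h0; rewrite (bigD1 A) //=; congr (_ + _).
have inj : {in A &, injective (fun i => A :\ i)}.
  move=> i j iA jA /setP/(_ i); rewrite !inE eqxx iA andbT /=.
  by case: eqP.
rewrite -(big_imset h inj) /= [LHS]big_mkcond [RHS]big_mkcond; apply: eq_bigr => T _ /=.
case: imsetP => [[i iA ->]|ne].
  rewrite subD1set /= ifT //; apply/eqP => /setP/(_ i).
  by rewrite !inE eqxx iA.
case: ifP => // /andP[TA TnA]; apply: h0 => //.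
rewrite ltnNge leq_eqVlt ltnS leqn0 cards_eq0 setD_eq0 negb_or; apply/andP; split.
  apply/negP => /cards1P[i ADT]; case: ne; exists i.
    by have : i \in A :\: T by [rewrite ADT inE]; rewrite inE => /andP[].
  by rewrite -ADT setDDr setDv set0U; apply/esym/setIidPr.
by apply: contraNN TnA => AT; rewrite eqEsubset TA.
Qed.

End SubsetSums.

(* d q^(2n) Tr (rho_T ^ 2), for T made of j factors C^q and, if b, of C^d. *)
Definition scaled_purity (R : pzSemiRingType) (d q : R) n (b : bool) j : R :=
  if (b + j <= n)%N then (if b then 1 else d) * q ^+ (n.*2 - j)
  else (if b then d else 1) * q ^+ j.

(* The signed sum of scaled purities over all T, with a minus sign at the sites
   where s holds, written so that it can be evaluated in binary integers. *)
Definition shadow (R : comNzRingType) (d q : R) n (s : nat -> bool) : R :=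
  dotprod (prod1cX (fun k => if s k.+1 then -1 else 1) n.*2)
    (fun k => scaled_purity d q n false k
              + (if s 0%N then -1 else 1) * scaled_purity d q n true k) 0.

(** * The inequalities for one factor C^d and 2n factors C^q *)

Section Dims.
Variables (C : numClosedFieldType) (d q n : nat).
Hypotheses (d_gt0 : (0 < d)%N) (q_gt0 : (0 < q)%N).
Variable psi : 'tvec[C]_(dims d q n).
Hypothesis psi_AME : AME psi.
Implicit Types S T A : {set 'I_(n.*2.+1)}.

Lemma dims_gt0 i : (0 < dims d q n i)%N.
Proof. by rewrite /dims; case: eqP. Qed.

Lemma prod_dims T :
  (\prod_(i in T) dims d q n i = (if ord0 \in T then d else 1) * q ^ #|T :\ ord0|)%N.
Proof.
have E : (\prod_(i in T :\ ord0) dims d q n i = q ^ #|T :\ ord0|)%N.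
  rewrite -prod_nat_const; apply: eq_bigr => i.
  by rewrite !inE /dims => /andP[/negbTE ->].
case: (boolP (ord0 \in T)) => T0; first by rewrite (big_setD1 ord0) //= E /dims eqxx.
rewrite mul1n -E; apply: eq_bigl => i; rewrite !inE.
by case: eqP => // ->; rewrite (negbTE T0).
Qed.

(** Up to [n] sites the purity is the inverse dimension; a larger set is replaced by its complement,
    which has at most [n] sites. *)
Lemma AME_scaled_purity T :
  d%:R * q%:R ^+ n.*2 * purity (amplitude psi) T
  = scaled_purity d%:R q%:R n (ord0 \in T) #|T :\ ord0|.
Proof.
have dn0 : d%:R != 0 :> C by rewrite pnatr_eq0 -lt0n.
have qn0 k : q%:R ^+ k != 0 :> C by rewrite expf_neq0 // pnatr_eq0 -lt0n.
have cI : #|'I_(n.*2.+1)|./2 = n by rewrite card_ord /= uphalf_double.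
have small S : (#|S| <= n)%N -> d%:R * q%:R ^+ n.*2 * purity (amplitude psi) S
    = (if ord0 \in S then 1 else d%:R) * q%:R ^+ (n.*2 - #|S :\ ord0|).
  move=> leS; rewrite (AME_purity dims_gt0 psi_AME) ?cI // prod_dims.
  have le2 : (#|S :\ ord0| <= n.*2)%N.
    move: leS; rewrite (cardsD1 ord0 S) => /(leq_trans (leq_addl _ _)) le_n.
    by rewrite (leq_trans le_n) // -addnn leq_addr.
  rewrite -[in X in _ * X / _](subnK le2) exprD natrM natrX.
  by case: ifP => _; field; rewrite ?dn0 qn0.
rewrite /scaled_purity -cardsD1; case: leqP => [/small //|ltT].
have cT : (#|T| + #|~: T| = n.*2.+1)%N by rewrite cardsC card_ord.
rewrite -purityC small; last first.
  move: cT ltT; move: #|T| #|~: T| => a b; clear; lia.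
have := cardsD1 ord0 T; have := cardsD1 ord0 (~: T).
rewrite !inE; case: (ord0 \in T) => /= cD cD'; congr (_ * _ ^+ _);
  move: cT ltT cD cD'; move: #|T| #|~: T| #|T :\ _| #|_ :\ _| => a b a' b'; clear; lia.
Qed.

Lemma AME_shadow_ge0 (s : nat -> bool) : 0 <= shadow (d%:R : C) q%:R n s.
Proof.
have N0 : 0 < d%:R * q%:R ^+ n.*2 :> C by rewrite mulr_gt0 ?exprn_gt0 ?ltr0n.
have := shadow_ge0 (amplitude psi) (fun i : 'I_(n.*2.+1) => s i).
rewrite -(pmulr_rge0 _ N0) mulr_sumr /shadow -sum_set_dotprod.
congr (_ <= _); apply: eq_bigr => T _.
rewrite -AME_scaled_purity mulrCA; congr (_ * _); apply: eq_bigr => i _.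
case: unliftP => [j ->|->]; rewrite ?lift0; case: (s _) => //.
Qed.

Lemma AME_weight_bound : (0 < n)%N -> (1 < d)%N ->
  (n.+1 * d <= d.+1 * q ^ 2)%N.
Proof.
move=> n_gt0 d_gt1.
have le_n : (n.+2 <= n.*2.+1)%N by lia.
(* The first n + 2 sites: C^d and n + 1 copies of C^q. They exist because 0 < n. *)
pose A : {set 'I_(n.*2.+1)} := [set widen_ord le_n i | i : 'I_n.+2].
have cA : #|A| = n.+2.
  by rewrite card_imset ?card_ord // => i j /(congr1 val) /= /val_inj.
have A0 : ord0 \in A by apply/imsetP; exists ord0 => //; apply: val_inj.
pose N : C := d%:R * q%:R ^+ n.*2.
have N0 : 0 < N by rewrite mulr_gt0 ?exprn_gt0 ?ltr0n.
pose P T : C := (\prod_(i in T) dims d q n i)%N%:R.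
(* Subtracting [N] is free, since its alternating sum over the subsets of [A] vanishes. It makes
   [h T] zero whenever [T] has at most [n] sites, so only [A] and its one-site deletions remain. *)
pose h T := (-1) ^+ #|A :\: T| * (P T * (N * purity (amplitude psi) T) - N).
have : 0 <= \sum_(T : {set 'I_(n.*2.+1)} | T \subset A) h T.
  have := weight_ge0 (amplitude psi) A dims_gt0.
  rewrite -(pmulr_rge0 _ N0) mulr_sumr.
  under [X in _ -> 0 <= X]eq_bigr do rewrite /h mulrBr.
  rewrite sumrB -mulr_suml sum_sign_subset ?mul0r ?subr0; last first.
    by apply/set0Pn; exists ord0.
  by congr (_ <= _); apply: eq_bigr => T _; rewrite /P; ring.
have dn0 : d%:R != 0 :> C by rewrite pnatr_eq0 -lt0n.
have qn0 k : q%:R ^+ k != 0 :> C by rewrite expf_neq0 // pnatr_eq0 -lt0n.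
have cI : #|'I_(n.*2.+1)|./2 = n by rewrite card_ord /= uphalf_double.
rewrite sum_corank_le1 => [|T TA lt1]; last first.
  rewrite /h (AME_purity dims_gt0 psi_AME); last first.
    rewrite cI; move: lt1; rewrite cardsD cA (setIidPr TA).
    by move: #|T| => a; clear; lia.
  rewrite mulrCA divff ?mulr1 ?subrr ?mulr0 //.
  by rewrite pnatr_eq0 -lt0n prodn_gt0 // => i; apply: dims_gt0.
pose x := (q%:R ^+ n.*2 : C).
have cA1 i : i \in A -> #|A :\ i| = n.+1.
  by move=> iA; apply/eqP; rewrite -eqSS -cA (cardsD1 i A) iA.
have hA : h A = d%:R * x * (d%:R * q%:R ^+ 2 - 1).
  rewrite /h setDv cards0 mul1r /P prod_dims AME_scaled_purity A0 cA1 //.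
  rewrite /scaled_purity add1n ltnNge leqnSn /= natrM natrX /N -/x.
  rewrite /x -addnn !exprD !exprS; ring.
have hA0 : h (A :\ ord0) = - (x * (q%:R ^+ 2 - d%:R)).
  rewrite /h setDDr setDv set0U (setIidPr _) ?sub1set // cards1 expr1.
  rewrite /P prod_dims AME_scaled_purity !inE eqxx /= setDDl setUid cA1 //.
  rewrite /scaled_purity add0n ltnn natrM natrX /N -/x.
  by rewrite /x -addnn !exprD !exprS; ring.
have hA1 i : i \in A :\ ord0 -> h (A :\ i) = - (d%:R * x * (d%:R - 1)).
  rewrite !inE eq_sym => /andP[i0 iA].
  have A0i : ord0 \in A :\ i by rewrite !inE i0.
  have cAi : #|A :\ i :\ ord0| = n.
    by apply/eqP; rewrite -eqSS -(cA1 i iA) (cardsD1 ord0 (A :\ i)) A0i.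
  rewrite /h setDDr setDv set0U (setIidPr _) ?sub1set // cards1 expr1.
  rewrite /P prod_dims AME_scaled_purity A0i cAi.
  rewrite /scaled_purity add1n ltnn natrM natrX /N -/x.
  by rewrite /x -addnn !exprD; ring.
rewrite (big_setD1 ord0) //= hA hA0 (eq_bigr _ hA1) sumr_const cA1 //.
(* The three kinds of terms share the factor [x * (d%:R - 1)], positive because 1 < d, and the other
   factor is the claimed difference. *)
rewrite -[X in _ + (_ + X)]mulr_natl [X in 0 <= X](_ : _ =
    x * (d%:R - 1) * ((d.+1 * q ^ 2)%N%:R - (n.+1 * d)%N%:R)); last first.
  by rewrite (natrM _ d.+1) natrX (natrM _ n.+1) -[d.+1]add1n natrD; ring.
by rewrite pmulr_rge0 ?subr_ge0 ?ler_nat // mulr_gt0 ?exprn_gt0 ?ltr0n // subr_gt0 ltr1n.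
Qed.

End Dims.

(** * Transfer of shadow sums along ring morphisms *)

Section ShadowMorphism.
Variables (R S : comNzRingType) (phi : {rmorphism R -> S}).

Lemma map_prod1cX (c : nat -> R) m :
  map phi (prod1cX c m) = prod1cX (phi \o c) m.
Proof.
have E e a l : map phi (mul1cX e a l) = mul1cX (phi e) (phi a) (map phi l).
  by elim: l a => [|b l IH] a /=; rewrite ?rmorphD rmorphM //= -/(mul1cX _ _ _) IH.
elim: m => [|m IH] /=; first by rewrite rmorph1.
by rewrite E rmorph0 -/(prod1cX c m) IH.
Qed.

Lemma rmorph_shadow (d q : R) n (s : nat -> bool) :
  phi (shadow d q n s) = shadow (phi d) (phi q) n s.
Proof.
have ps b k : phi (scaled_purity d q n b k) = scaled_purity (phi d) (phi q) n b k.
  rewrite /scaled_purity; case: ifP => _; rewrite rmorphM rmorphXn; congr (_ * _);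
    by case: b; rewrite ?rmorph1.
have ph b : phi (if b then -1 else 1) = if b then -1 else 1.
  by case: b; rewrite ?rmorphN rmorph1.
rewrite /shadow !dotprodE rmorph_sum !size_prod1cX; apply: eq_bigr => k _ /=.
rewrite rmorphM rmorphD rmorphM !ps ph -(nth_map _ 0) ?size_prod1cX // map_prod1cX.
congr (_`_k * _).
by apply: eq_iteri => i l /=; rewrite ph.
Qed.

End ShadowMorphism.

(** * Exact evaluation of the remaining cases and conclusion *)

(** The shadow sum is a polynomial expression in integers, so its sign can be computed in [Z] and
    carried to [C] by the canonical morphism. *)
Lemma shadow_lt0_no_AME (C : numClosedFieldType) (d q n : nat) (s : nat -> bool) :
    (0 < d)%N -> (0 < q)%N ->
    BinInt.Z.ltb (shadow (BinInt.Z.of_nat d) (BinInt.Z.of_nat q) n s) 0 ->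
  ~ exists psi : 'tvec[C]_(dims d q n), AME psi.
Proof.
move=> d_gt0 q_gt0 lt0 [psi psi_AME].
pose phi : {rmorphism BinNums.Z -> C} := (intmul 1 \o int_of_Z).
have phiE k : phi (BinInt.Z.of_nat k) = k%:R by rewrite /phi /= (Z_of_intK k).
have := AME_shadow_ge0 d_gt0 q_gt0 psi_AME s.
rewrite -!phiE -rmorph_shadow /phi /= ler0z.
by case: (shadow _ _ _ _) lt0.
Qed.

(* Found by evaluating all shadow inequalities numerically. *)
Definition minus_sites (d n k : nat) : bool :=
  if d == 2%N then (0 < k <= if odd n then n.*2 - 2 else n.*2)%N
  else if odd n then (0 < k)%N else (k < n.*2)%N.

(** Contains every triple (d, q, n) covered by the theorem with (n + 1) d <= (d + 1) q^2. *)
Definition small_cases : seq (nat * nat * nat) :=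
  ([seq (d, 2, 4) | d <- [:: 3; 4]]
   ++ [seq (2, 3, n) | n <- [:: 6; 8; 9; 10; 11; 12]]
   ++ [seq (d, 3, n) | d <- [:: 4; 5; 6; 7; 8], n <- [:: 6; 8; 9; 10]]
   ++ [seq (9, 3, n) | n <- [:: 6; 8]])%N.

Lemma shadow_lt0_small :
  all (fun t => let: (d, q, n) := t in BinInt.Z.ltb
    (shadow (BinInt.Z.of_nat d) (BinInt.Z.of_nat q) n (minus_sites d n)) 0)
  small_cases.
Proof. by vm_compute. Qed.

Local Open Scope complex_scope.

Theorem proposition12 (R : realType) (d n : nat) (d_gt0 : (0 < d)%N) (n_gt0 : (0 < n)%N) :
  ((d = 3 \/ d = 4)%N -> (4 <= n)%N ->
     ~ exists psi : 'tvec[R[i]]_(dims d 2 n), AME psi)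
  /\
  ((((2 <= d <= 8)%N /\ d <> 3%N /\ (6 <= n)%N /\ n <> 7%N)
     \/ (d = 9%N /\ (6 <= n)%N /\ n <> 7%N /\ n <> 9%N)) ->
     ~ exists psi : 'tvec[R[i]]_(dims d 3 n), AME psi).
Proof.
have large q : (0 < q)%N -> (1 < d)%N -> (d.+1 * q ^ 2 < n.+1 * d)%N ->
    ~ exists psi : 'tvec[R[i]]_(dims d q n), AME psi.
  move=> q_gt0 d_gt1; rewrite ltnNge => /negP big [psi psi_AME]; apply: big.
  exact: (AME_weight_bound d_gt0 q_gt0 psi_AME).
have small q : (0 < q)%N -> (d, q, n) \in small_cases ->
    ~ exists psi : 'tvec[R[i]]_(dims d q n), AME psi.
  by move=> q_gt0 /(allP shadow_lt0_small); apply: shadow_lt0_no_AME.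
split=> [d34 n_ge4|dn].
  (* For q = 2 the weight bound reads 3 (n + 1) <= 16 or 4 (n + 1) <= 20, so it fails once n > 4. *)
  have [n_gt4|n_le4] := ltnP 4 n; first by apply: large => //; case: d34 => ->; lia.
  have n4 : n = 4%N by lia.
  by apply: small => //; case: d34 => ->; rewrite n4.
case: (leqP (n.+1 * d) (d.+1 * 3 ^ 2)) => [le_n|]; last first.
  by apply: large => //; lia.
apply: small => //.
have : d \in [:: 2; 4; 5; 6; 7; 8; 9]%N by rewrite !inE; lia.
rewrite !inE.
(* [le_n] forces n <= 12 for d = 2, n <= 9 for d = 9 and n <= 10 for the other d; removing the
   excluded values of n leaves these lists. *)
have dn' : if d == 2%N then n \in [:: 6; 8; 9; 10; 11; 12]%N
  else if d == 9%N then n \in [:: 6; 8]%N else n \in [:: 6; 8; 9; 10]%N.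
  case: ifP => [/eqP d2|d2]; last case: ifP => [/eqP d9|d9]; rewrite !inE; nia.
by do ?[case/orP]; move/eqP=> Ed; move: dn'; rewrite Ed /= !inE; do ?[case/orP]; move/eqP => ->.
Qed.
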